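(* Let $(\mathbb{R}^d,\mathbb{R}^m,\mathcal{L})$ be a fully Euclidean cut and project scheme and let $\curlywedge(W)$ be a model set in it. Then: (a) Any arithmetic progression of length $N\geq 1$ in $\curlywedge(W)$ has rank at most $d+m$. (b) For each $N\in\mathbb{N}$ there exists some $R>0$ such that, for all $y\in\mathbb{R}^d$, the set $\curlywedge(W)\cap B_R(y)$ contains an li-arithmetic progression of length $N$ and rank $d+m$.
   Context: Here $d\ge 1$, $m\ge 0$ are integers and $B_R(y)$ is the ball of radius $R$ centred at $y$. A fully Euclidean cut and project scheme (CPS) $(\mathbb{R}^d,\mathbb{R}^m,\mathcal{L})$ consists of $\mathbb{R}^d$, $\mathbb{R}^m$ and a lattice (discrete co-compact subgroup) $\mathcal{L}\subset\mathbb{R}^d\times\mathbb{R}^m$ such that the canonical projection $\mathbb{R}^d\times\mathbb{R}^m\to\mathbb{R}^d$ is injective on $\mathcal{L}$ and the image of $\mathcal{L}$ under the canonical projection to $\mathbb{R}^m$ is dense in $\mathbb{R}^m$. For $W\subseteq\mathbb{R}^m$, $\curlywedge(W):=\{x\in\mathbb{R}^d : \exists\, y\in W \text{ with } (x,y)\in\mathcal{L}\}$. It is called a (fully Euclidean) model set when $W$ is precompact and has non-empty interior. An ($n$-dimensional) arithmetic progression of length $N$ is a set $\{s+c_1r_1+\dots+c_nr_n : c_j\in\mathbb{Z},\ 0\le c_j\le N\ \forall j\}$ with $s,r_1,\dots,r_n\in\mathbb{R}^d$; the $r_j$ are its ratios. Its rank is the rank of the $\mathbb{Z}$-module generated by $\{r_1,\dots,r_n\}$.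 It is an li-arithmetic progression if $r_1,\dots,r_n$ are linearly independent over $\mathbb{Z}$ (so that its rank equals its dimension $n$). *)

(* Defs.v *)
From HB Require Import structures.
From mathcomp Require Import all_boot all_order all_algebra.
From mathcomp Require Import all_classical all_reals all_analysis.

Set Implicit Arguments.
Unset Strict Implicit.
Unset Printing Implicit Defensive.

Import Order.TTheory GRing.Theory Num.Theory.
Import numFieldNormedType.Exports.

Local Open Scope classical_set_scope.
Local Open Scope ring_scope.

(* The library norm on row vectors is the sup norm, so the Euclidean ball has
   to be spelled out. *)
Definition euclidean_ball (R : realType) (d : nat) (y : 'rV[R]_d) (rho : R) :
    set 'rV[R]_d :=
  [set x | Num.sqrt (\sum_(i < d) (x ord0 i - y ord0 i) ^+ 2) < rho].

(* [Quotient.quot L] is the quotient group of the library; it is given the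
   quotient topology, so the last clause says that L is co-compact. *)
Definition is_lattice (R : realType) (d m : nat)
    (L : zmodClosed ('rV[R]_d * 'rV[R]_m)%type) : Prop :=
  [set` L] `<=` isolated [set` L] /\
  compact [set: quotient_topology (Quotient.quot L)].

Record is_CPS (R : realType) (d m : nat)
    (L : zmodClosed ('rV[R]_d * 'rV[R]_m)%type) : Prop := IsCPS {
  CPS_lattice : is_lattice L;
  CPS_inj : {in L &, injective (@fst 'rV[R]_d 'rV[R]_m)};
  CPS_dense : dense (@snd 'rV[R]_d 'rV[R]_m @` [set` L])
}.

Definition cut_project (R : realType) (d m : nat)
    (L : zmodClosed ('rV[R]_d * 'rV[R]_m)%type) (W : set 'rV[R]_m) :
    set 'rV[R]_d :=
  [set x | exists2 y, W y & (x, y) \in L].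

Definition is_model_window (R : realType) (m : nat) (W : set 'rV[R]_m) : Prop :=
  precompact W /\ W° !=set0.

Definition arith_prog (V : zmodType) (n N : nat) (s : V) (r : 'I_n -> V) :
    set V :=
  [set x | exists2 c : 'I_n -> int,
    forall j, (0 <= c j <= N%:Z) & x = s + \sum_(j < n) r j *~ c j].

Definition zfree (V : zmodType) (n : nat) (r : 'I_n -> V) : Prop :=
  forall c : 'I_n -> int,
    \sum_(j < n) r j *~ c j = 0 -> forall j, c j = 0.

Definition zspan (V : zmodType) (n : nat) (r : 'I_n -> V) : set V :=
  [set x | exists c : 'I_n -> int, x = \sum_(j < n) r j *~ c j].

(* The rank of a Z-module is the largest size of a Z-linearly independent
   family of its elements; it is a relation because it need not be finite. *)
Definition has_zrank (V : zmodType) (M : set V) (k : nat) : Prop :=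
  (exists v : 'I_k -> V, (forall i, M (v i)) /\ zfree v) /\
  (forall (l : nat) (v : 'I_l -> V),
     (forall i, M (v i)) -> zfree v -> (l <= k)%N).

(* Main.v *)
Require Import Defs.
From HB Require Import structures.
From mathcomp Require Import all_boot all_order all_algebra.
From mathcomp Require Import all_classical all_reals all_analysis.
From mathcomp Require Import lra.

(** Write D = d + m, and identify a point of R^d x R^m with a row vector of
    length D.

    Part (a).  The start and the translates of it by one ratio lie in the
    projection of L, so every ratio, hence the Z-span of the ratios, lies in
    the projection of L to R^d.  A Z-free family there lifts to a Z-free
    family in L, so it is enough that a Z-free family v of a discrete group
    L has at most D members ([zfree_discrete_le]).  This is Dirichlet's
    argument: more than D vectors have a real relation sum_j t_j v_j = 0 with
    some t_i = 1; the lattice points u_k = sum_j floor(k t_j) v_j differ from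
    k sum_j t_j v_j = 0 by a bounded amount, so two of them are closer than
    the gap of L and therefore equal, and freeness forces
    floor(k t_i) = floor(k' t_i), that is, k = k'.

    Part (b).  Co-compactness and density of the second projection show that,
    over any target z in R^m up to an error e, the points of L are relatively
    dense in R^d ([relatively_dense]).  With targets close to the rows of the
    diagonal matrix diag(T, ..., T, delta, ..., delta), with T large compared
    to the relative density radius, this gives D points of L whose matrix of
    coordinates is diagonally dominant, hence invertible
    ([near_diag_row_free]).  They form a Z-free family with second components
    as short as desired ([exists_short_zfree]); as the first projection is
    injective on L, their first components are still Z-free.  These serve as
    ratios for every y, and only the start s is chosen near y, with second
    component near an interior point of W: the coordinates of the progression
    in R^m stay in W because the ratios move them by very little. *)

Set Implicit Arguments.
Unset Strict Implicit.
Unset Printing Implicit Defensive.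

Import Order.TTheory GRing.Theory Num.Theory.
Import numFieldNormedType.Exports.

Local Open Scope classical_set_scope.
Local Open Scope ring_scope.

(** * The sup norm on row vectors *)

Lemma normr_rV_coord (R : realType) (n : nat) (z : 'rV[R]_n) (j : 'I_n) :
  `|z 0 j| <= `|z|.
Proof.
rewrite [leRHS]/Num.Def.normr /= mx_normrE.
exact: (le_bigmax _ (fun ij => `|z ij.1 ij.2|) (0, j)).
Qed.

Lemma normr_rV_coordB (R : realType) (n : nat) (x y : 'rV[R]_n) (j : 'I_n) :
  `|x 0 j - y 0 j| <= `|x - y|.
Proof. by have := normr_rV_coord (x - y) j; rewrite !mxE. Qed.

Lemma normr_rV_le (R : realType) (n : nat) (z : 'rV[R]_n) (b : R) :
  0 <= b -> (forall j, `|z 0 j| <= b) -> `|z| <= b.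
Proof.
move=> b0 zb; rewrite [leLHS]/Num.Def.normr /= mx_normrE.
by apply: bigmax_le => // -[i j] _ /=; rewrite ord1.
Qed.

(** The Euclidean norm is at most sqrt d times the sup norm; the radius is
    linear in b, and the 1 in it makes the inequality strict. *)
Lemma in_euclidean_ball (R : realType) (d : nat) (x y : 'rV[R]_d) (b : R) :
  `|x - y| <= b -> euclidean_ball y (d%:R * b + 1) x.
Proof.
move=> xyb; have b0 : 0 <= b by apply: le_trans xyb.
have db0 : 0 < d%:R * b + 1 by rewrite ltr_wpDl // mulr_ge0.
rewrite /euclidean_ball /= -[ltRHS]gtr0_norm // -sqrtr_sqr ltr_sqrt ?exprn_gt0 //.
have : \sum_(i < d) (x ord0 i - y ord0 i) ^+ 2 <= \sum_(i < d) b ^+ 2.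
  apply: ler_sum => i _; rewrite -real_normK ?num_real // lerXn2r ?nnegrE //.
  exact: le_trans (normr_rV_coordB _ _ i) xyb.
rewrite sumr_const card_ord -mulr_natl => /le_lt_trans; apply.
(* (d b + 1)^2 exceeds d^2 b^2, and d <= d^2 as d is an integer. *)
have dd : d%:R <= d%:R * d%:R :> R.
  by rewrite -natrM ler_nat; case: (d) => // k; rewrite leq_pmulr.
have : d%:R * b ^+ 2 <= d%:R * d%:R * b ^+ 2 by rewrite ler_wpM2r ?exprn_ge0.
have : 0 <= d%:R * b by rewrite mulr_ge0.
rewrite !expr2; lra.
Qed.

(** Total boundedness, with the net given as a list so that a pigeonhole can be
    run on it and sums can be taken over it. *)
Lemma bounded_net (R : realType) (n : nat) (C e : R) : 0 < e ->
  exists G : seq 'rV[R]_n,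
    forall z, `|z| <= C -> exists2 g, g \in G & `|z - g| < e.
Proof.
move=> e0.
pose K := [set v : 'rV[R]_n | forall i, v ord0 i \in `[- C, C]].
have cK : compact K.
  apply: (@rV_compact _  _ (fun=> `[- C, C]%classic)).
  by move=> _; apply: segment_compact.
move: cK; rewrite compact_cover => /(_ 'rV[R]_n setT (fun g => ball g e)).
case=> [g _|v _|G _ KG].
- exact: ball_open.
- by exists v => //; exact: ballxx.
exists (finmap.enum_fset G) => z zC.
have [|g gG] := KG z; last first.
  by rewrite -ball_normE /= distrC => ?; exists g.
move=> i; rewrite in_itv /= -ler_norml; apply: le_trans zC.
exact: normr_rV_coord.
Qed.

Lemma net_pair (R : realType) (d m : nat) (C e : R) : 0 < e ->
  exists G : seq ('rV[R]_d * 'rV[R]_m)%type,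
    forall z, `|z| <= C -> exists2 g, g \in G & `|z - g| < e.
Proof.
move=> e0; have [G1 hG1] := @bounded_net R d C e e0.
have [G2 hG2] := @bounded_net R m C e e0.
exists [seq (a, b) | a <- G1, b <- G2] => -[z1 z2].
rewrite prod_normE /= ge_max => /andP[/hG1[g1 g1G zg1] /hG2[g2 g2G zg2]].
exists (g1, g2); first exact: allpairs_f.
by rewrite prod_normE /= gt_max zg1.
Qed.

(** * Integer combinations, spans and rank *)

Lemma normr_zcomb (R : numDomainType) (V : normedZmodType R) (n : nat)
    (v : 'I_n -> V) (N : nat) (c : 'I_n -> int) :
  (forall j, 0 <= c j <= N%:Z) ->
  `|\sum_j v j *~ c j| <= N%:R * \sum_j `|v j|.
Proof.
move=> c0N; apply: le_trans (ler_norm_sum _ _ _) _.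
rewrite mulr_sumr; apply: ler_sum => j _; have := c0N j.
case: (c j) => // k; rewrite -pmulrn normrMn -[_ *+ k]mulr_natl => /andP[_ kN].
by apply: ler_wpM2r => //; rewrite ler_nat.
Qed.

Lemma zcomb_in (V : zmodType) (L : zmodClosed V) (n : nat) (v : 'I_n -> V)
    (c : 'I_n -> int) :
  (forall j, v j \in L) -> \sum_j v j *~ c j \in L.
Proof. by move=> vL; apply: rpred_sum => j _; apply: rpredMz. Qed.

Lemma sum_mulrz_delta (V : zmodType) (n : nat) (r : 'I_n -> V) (i : 'I_n) :
  \sum_j r j *~ (j == i)%:Z = r i.
Proof.
rewrite (bigD1 i) //= eqxx mulr1z big1 ?addr0 // => j /negPf ->.
by rewrite mulr0z.
Qed.

Lemma zspan_ratio (V : zmodType) (n : nat) (r : 'I_n -> V) i : zspan r (r i).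
Proof. by exists (fun j => (j == i)%:Z); rewrite sum_mulrz_delta. Qed.

Lemma arith_prog_start (V : zmodType) (n N : nat) (s : V) (r : 'I_n -> V) :
  arith_prog N s r s.
Proof.
exists (fun=> 0) => [j|]; first by rewrite lexx.
by rewrite big1 ?addr0 // => j _; rewrite mulr0z.
Qed.

Lemma arith_prog_ratio (V : zmodType) (n N : nat) (s : V) (r : 'I_n -> V) i :
  (1 <= N)%N -> arith_prog N s r (s + r i).
Proof.
move=> N1; exists (fun j => (j == i)%:Z) => [j|]; last by rewrite sum_mulrz_delta.
by case: (j == i); rewrite ?lexx //= lez_nat.
Qed.

Lemma bounded_has_zrank (V : zmodType) (M : set V) (b : nat) :
  (forall l (v : 'I_l -> V), (forall i, M (v i)) -> zfree v -> (l <= b)%N) ->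
  exists k, has_zrank M k /\ (k <= b)%N.
Proof.
move=> Mb.
pose P k := `[< exists v : 'I_k -> V, (forall i, M (v i)) /\ zfree v >].
have P0 : exists k, P k.
  by exists 0%N; apply/asboolP; exists (fun=> 0); split => [[]|c _ []].
have Pb k : P k -> (k <= b)%N by move=> /asboolP[v [Mv]]; exact: Mb.
case: (ex_maxnP P0 Pb) => k Pk kmax; exists k; split; last exact: Pb.
split; first exact/asboolP.
by move=> l v Mv vfree; apply: kmax; apply/asboolP; exists v.
Qed.

(** * Discrete and co-compact subgroups *)

(** As L is stable under differences, e is also a lower bound for the distance
    between two distinct points of L. *)
Lemma discrete_gap (R : realType) (V : normedModType R) (L : zmodClosed V) :
  [set` L] `<=` isolated [set` L] ->
  exists2 e : R, 0 < e & forall l, l \in L -> `|l| < e -> l = 0.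
Proof.
move=> iso; have [_ [U U0 UL]] := iso 0 (rpred0 L).
move/nbhs_normP: U0 => [e /= e0 eU]; exists e => // l lL le.
have : (U `&` [set` L]) l by split => //; apply: eU; rewrite /= sub0r normrN.
by rewrite UL.
Qed.

(** The images in the quotient of the balls of radius C centred at 0 are open
    and increase to the whole quotient with C, so by compactness one of them
    is the whole quotient. *)
Lemma cocompact_bound (R : realType) (V : normedModType R) (L : zmodClosed V) :
  compact [set: quotient_topology (Quotient.quot L)] ->
  exists2 C : R, 0 < C & forall p, exists2 l, l \in L & `|p - l| < C.
Proof.
move=> /compact_near_coveringP covL.
set Q := quotient_topology (Quotient.quot L) in covL *.
pose P (C : R) (q : Q) := exists2 p : V, `|p| < C & \pi_Q%qT p = q.
have piE x y : \pi_Q%qT x = \pi_Q%qT y <-> x - y \in L.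
  rewrite Quotient.idealrBE; split => [e|/eqP e]; last exact: e.
  by apply/eqP; exact: e.
have nearP (q : Q) : [set: Q] q -> \forall q' \near q & C \near +oo, P C q'.
  move=> _; pose p : V := generic_quotient.repr q.
  exists ([set q' | P (`|p| + 1) q'], [set C | `|p| + 1 < C]) => /=; last first.
    by move=> [q' C] /= [[p' p'p <-] pC]; exists p' => //; exact: lt_trans pC.
  split; last by apply: nbhs_pinfty_gt; rewrite num_real.
  (* The set is open: its preimage in V is a union of balls centred on L. *)
  apply: (@open_nbhs_nbhs Q); split; last first.
    by exists p; [rewrite ltrDl|exact: generic_quotient.reprK].
  rewrite /open /= /quotient_open.
  have -> : \pi_Q%qT @^-1` [set q' | P (`|p| + 1) q']
      = \bigcup_(l in [set` L]) ball l (`|p| + 1).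
    apply/seteqP; split => [x [p' p'p /esym/piE xL]|x [l lL]].
      by exists (x - p') => //; rewrite -ball_normE /= addrAC subrr add0r normrN.
    rewrite -ball_normE /= => lx; exists (x - l); first by rewrite distrC.
    by apply/piE; rewrite addrAC subrr add0r rpredN.
  by apply: bigcup_open => l _; exact: ball_open.
have /filter_ex[C [C0 PC]] : \forall C \near +oo, 0 < C /\ [set: Q] `<=` P C.
  apply: filterI; first exact: nbhs_pinfty_gt.
  exact: covL nearP.
exists C => // p; have [//|p' p'C /esym/piE pL] := PC (\pi_Q%qT p).
by exists (p - p') => //; rewrite opprB addrC subrK.
Qed.

(** * Free families in a discrete group *)

Definition coord_mx (R : realType) (d m l : nat)
    (v : 'I_l -> 'rV[R]_d * 'rV[R]_m) : 'M[R]_(l, d + m) :=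
  \matrix_k row_mx (v k).1 (v k).2.

Lemma mul_coord_mx (R : realType) (d m l : nat)
    (v : 'I_l -> 'rV[R]_d * 'rV[R]_m) (u : 'rV[R]_l) :
  u *m coord_mx v =
  row_mx (\sum_k u 0 k *: v k).1 (\sum_k u 0 k *: v k).2.
Proof.
rewrite mulmx_sum_row !raddf_sum /=.
under eq_bigr do rewrite rowK scale_row_mx.
by elim/big_ind3: _ => [|x x' a y y' b -> ->|//]; rewrite ?row_mx0 ?add_row_mx.
Qed.

Lemma exists_dependence (R : realType) (d m l : nat)
    (v : 'I_l -> 'rV[R]_d * 'rV[R]_m) : (d + m < l)%N ->
  exists t : 'I_l -> R, (exists i, t i = 1) /\ \sum_k t k *: v k = 0.
Proof.
move=> dml; have : kermx (coord_mx v) != 0.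
  rewrite kermx_eq0 /row_free neq_ltn.
  by rewrite (leq_ltn_trans (rank_leq_col _) dml).
case/rowV0Pn => u /sub_kermxP + /rV0Pn[i ui0].
rewrite mul_coord_mx -row_mx0 => /eq_row_mx[u1 u2].
have u12 : \sum_k u 0 k *: v k = 0.
  by rewrite [LHS]surjective_pairing u1 u2.
exists (fun k => (u 0 i)^-1 * u 0 k); split; first by exists i; rewrite mulVf.
by under eq_bigr do rewrite -scalerA; rewrite -scaler_sumr u12 scaler0.
Qed.

Lemma pigeonhole (T : eqType) (G : seq T) (g : nat -> T) :
  (forall k, g k \in G) -> exists k k', k <> k' /\ g k = g k'.
Proof.
move=> gG; pose f (k : 'I_(size G).+1) : 'I_(size G) :=
  Ordinal (eq_ind_r is_true (gG k) (index_mem (g k) G)).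
have /injectivePn[k [k' kk' fkk']] : ~~ injectiveb f.
  by apply/injectiveP => /leq_card; rewrite !card_ord ltnn.
exists k, k'; split; first by move/val_inj/eqP; exact/negP.
have /(congr1 val) /= := fkk'.
by move=> e; rewrite -(nth_index (g k) (gG k)) e nth_index.
Qed.

(** A real relation among the v_j becomes an integral one by simultaneous
    approximation, because the gap of L turns nearly equal combinations into
    equal ones. *)
Lemma zfree_discrete_le (R : realType) (d m l : nat)
    (L : zmodClosed ('rV[R]_d * 'rV[R]_m)%type)
    (v : 'I_l -> 'rV[R]_d * 'rV[R]_m) :
  [set` L] `<=` isolated [set` L] ->
  (forall i, v i \in L) -> zfree v -> (l <= d + m)%N.
Proof.
move=> /discrete_gap[e e0 eL] vL vfree; rewrite leqNgt; apply/negP.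
move=> /(exists_dependence v)[t [[i ti1] t0]].
pose c (k : nat) (j : 'I_l) := Num.floor (k%:R * t j).
pose u k := \sum_j v j *~ c k j.
have uC k : `|u k| <= \sum_j `|v j|.
  (* The subtracted term is k times the relation t0. *)
  have -> : u k = \sum_j ((c k j)%:~R - k%:R * t j) *: v j.
    under eq_bigr do rewrite scalerBl scaler_int -scalerA.
    by rewrite sumrB -scaler_sumr t0 scaler0 subr0.
  apply: le_trans (ler_norm_sum _ _ _) _; apply: ler_sum => j _.
  rewrite normrZ ler_piMl // ler_norml.
  have /andP[] := floor_itv (k%:R * t j); rewrite -/(c k j) intrD.
  lra.
have e20 : 0 < e / 2 by rewrite divr_gt0.
have [G uG] := @net_pair R d m (\sum_j `|v j|) (e / 2) e20.
have /choice[g gP] k : exists g, g \in G /\ `|u k - g| < e / 2.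
  by have [g] := uG _ (uC k); exists g.
have [k [k' [kk' gkk']]] := pigeonhole (fun k => (gP k).1).
apply: kk'; have uB : u k - u k' = \sum_j v j *~ (c k j - c k' j).
  by rewrite -sumrB; apply: eq_bigr => j _; rewrite mulrzBr.
(* u_k and u_k' have a common neighbour in the net, so they differ by less
   than the gap of L. *)
have uB0 : u k - u k' = 0.
  apply: eL; first by rewrite uB; apply: zcomb_in.
  have := ltrD (gP k).2 (gP k').2; rewrite -splitr; apply: le_lt_trans.
  by rewrite (distrC (u k')) -gkk'; exact: ler_distD.
have /eqP := vfree _ (etrans (esym uB) uB0) i.
by rewrite subr_eq0 /c ti1 !mulr1 !pmulrn !intrKfloor => /eqP[].
Qed.

(** Any choice of lifts works, since a relation among the lifts projects to one
    among the v_i. *)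
Lemma zfree_fst_le (R : realType) (d m l : nat)
    (L : zmodClosed ('rV[R]_d * 'rV[R]_m)%type) (v : 'I_l -> 'rV[R]_d) :
  [set` L] `<=` isolated [set` L] ->
  (forall i, (fst @` [set` L]) (v i)) -> zfree v -> (l <= d + m)%N.
Proof.
move=> discL vL vfree.
have /choice[p pP] i : exists p, p \in L /\ p.1 = v i.
  by have [p pL <-] := vL i; exists p.
apply: (zfree_discrete_le discL (fun i => (pP i).1)) => c pc0.
apply: vfree; under eq_bigr do rewrite -(pP _).2 -raddfMz.
by rewrite -raddf_sum pc0.
Qed.

Lemma zspan_fst (R : realType) (d m n : nat)
    (L : zmodClosed ('rV[R]_d * 'rV[R]_m)%type) (r : 'I_n -> 'rV[R]_d) :
  (forall i, (fst @` [set` L]) (r i)) -> zspan r `<=` fst @` [set` L].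
Proof.
move=> rL; have /choice[p pP] i : exists p, p \in L /\ p.1 = r i.
  by have [p pL <-] := rL i; exists p.
move=> _ [c ->]; exists (\sum_j p j *~ c j) => /=.
  by apply: zcomb_in => j; have [] := pP j.
rewrite raddf_sum; apply: eq_bigr => j _.
by rewrite raddfMz /= (pP j).2.
Qed.

(** * Short free families in a lattice *)

Lemma row_free_zfree (R : realType) (d m l : nat)
    (v : 'I_l -> 'rV[R]_d * 'rV[R]_m) : row_free (coord_mx v) -> zfree v.
Proof.
move=> freev c vc0 j.
have : (\row_k (c k)%:~R : 'rV[R]_l) *m coord_mx v = 0.
  rewrite mul_coord_mx; under eq_bigr do rewrite mxE scaler_int.
  by rewrite vc0 row_mx0.
move/eqP; rewrite mulmx_free_eq0 // => /eqP/rowP/(_ j).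
by rewrite !mxE => /eqP; rewrite intr_eq0 => /eqP.
Qed.

(** Diagonal dominance by columns.  If u M = 0 and S is the sum of the |u_k|,
    column i gives |u_i| w_i <= S w_i / (n + 1); summing over i gives
    S <= S n / (n + 1), so S = 0.  Since the columns are compared one at a
    time, the scales w_i may be very different. *)
Lemma near_diag_row_free (R : realType) (n : nat) (w : 'rV[R]_n) (M : 'M[R]_n) :
  (forall i, 0 < w 0 i) ->
  (forall k i, `|M k i - diag_mx w k i| <= w 0 i / n.+1%:R) ->
  row_free M.
Proof.
move=> w0 Mw.
have ker0 (u : 'rV[R]_n) : u *m M = 0 -> u = 0.
  move=> uM0; pose S := \sum_k `|u 0 k|.
  have S0 : 0 <= S by apply: sumr_ge0.
  have uS i : `|u 0 i| <= S / n.+1%:R.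
    have : u 0 i * w 0 i = - \sum_k u 0 k * (M k i - diag_mx w k i).
      have /rowP/(_ i) := uM0; rewrite !mxE => uMi.
      under eq_bigr do rewrite mulrBr.
      rewrite sumrB uMi sub0r opprK (bigD1 i) //= !mxE eqxx mulr1n big1 ?addr0 //.
      by move=> k ki; rewrite !mxE (negPf ki) mulr0n mulr0.
    move/(congr1 Num.norm); rewrite normrM normrN (gtr0_norm (w0 i)) => uw.
    rewrite -(ler_pM2r (w0 i)) uw mulrAC -mulrA mulr_suml.
    apply: le_trans (ler_norm_sum _ _ _) _; apply: ler_sum => k _.
    by rewrite normrM ler_wpM2l.
  have SS : S <= n%:R * (S / n.+1%:R).
    apply: le_trans (ler_sum _ (fun i _ => uS i)) _.
    by rewrite sumr_const card_ord mulr_natl.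
  have S00 : S = 0.
    apply/eqP; rewrite eq_le S0 andbT.
    move: SS; rewrite mulrCA -subr_le0 -[X in X - _]mulr1 -mulrBr.
    rewrite pmulr_lle0 // subr_gt0 ltr_pdivrMr ?ltr0n // mul1r ltr_nat.
    exact: ltnSn.
  apply/rowP => i; rewrite mxE; apply/eqP; rewrite -normr_le0.
  by apply: le_trans (uS i) _; rewrite S00 mul0r.
rewrite -kermx_eq0; apply/eqP/row_matrixP => i.
by rewrite row0; apply: ker0; rewrite -row_mul mulmx_ker row0.
Qed.

(** Co-compactness gives a lattice point near (y, 0).  Its second component is
    bounded, so the correction needed to bring it near z stays in a fixed ball
    of R^m; by density and total boundedness finitely many lattice points
    provide all these corrections, and they move the first component by a
    bounded amount. *)
Lemma relatively_dense (R : realType) (d m : nat)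
    (L : zmodClosed ('rV[R]_d * 'rV[R]_m)%type) (C e : R) :
  compact [set: quotient_topology (Quotient.quot L)] ->
  dense (@snd 'rV[R]_d 'rV[R]_m @` [set` L]) -> 0 < e ->
  exists2 rho : R, 0 < rho & forall y z, `|z| <= C ->
    exists2 p, p \in L & `|p.1 - y| <= rho /\ `|p.2 - z| < e.
Proof.
move=> /cocompact_bound[C0 C00 covL] dL e0.
have e20 : 0 < e / 2 by rewrite divr_gt0.
have [G hG] := @bounded_net R m (C + C0) (e / 2) e20.
have /choice[h hP] (g : 'rV[R]_m) : exists p, p \in L /\ `|p.2 - g| < e / 2.
  have [||x [/= gx [p /= pL px]]] := dL (ball g (e / 2)).
  - by exists g; exact: ballxx.
  - exact: ball_open.
  by exists p; split => //; rewrite px distrC; move: gx; rewrite -ball_normE.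
exists (C0 + \sum_(g <- G) `|(h g).1|).
  by rewrite ltr_pwDl // sumr_ge0.
move=> y z zC; have [l lL] := covL (y, 0).
rewrite prod_normE /= sub0r normrN gt_max => /andP[yl l2].
have [|g gG zg] := hG (z - l.2).
  by apply: le_trans (ler_normB _ _) _; rewrite lerD // ltW.
exists (l + h g) => /=; first by rewrite rpredD // (hP g).1.
split.
  rewrite addrAC; apply: le_trans (ler_normD _ _) _.
  apply: lerD; first by rewrite distrC ltW.
  by rewrite (big_rem g) //= lerDl sumr_ge0.
have -> : l.2 + (h g).2 - z = ((h g).2 - g) - (z - l.2 - g).
  by rewrite opprB addrA subrK opprB [RHS]addrA (addrC l.2).
apply: le_lt_trans (ler_normB _ _) _.
by rewrite [e]splitr ltrD // (hP g).2.
Qed.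

(** The k-th vector is taken near the k-th row of the diagonal matrix P with
    entries T (d times) and delta (m times).  The error
    delta / (d + m + 1) on the last m coordinates is fixed first; it
    determines the error rho on the first d, which T = (d + m + 1) rho then
    dominates. *)
Lemma exists_short_zfree (R : realType) (d m : nat)
    (L : zmodClosed ('rV[R]_d * 'rV[R]_m)%type) (e : R) :
  compact [set: quotient_topology (Quotient.quot L)] ->
  dense (@snd 'rV[R]_d 'rV[R]_m @` [set` L]) -> 0 < e ->
  exists v : 'I_(d + m) -> 'rV[R]_d * 'rV[R]_m,
    [/\ forall k, v k \in L, zfree v & forall k, `|(v k).2| <= e].
Proof.
move=> cL dL e0; pose D : R := (d + m).+1%:R; pose delta := e / 2.
have delta0 : 0 < delta by rewrite divr_gt0.
have D1 : 1 <= D by rewrite ler1n.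
have D0 : 0 < D by apply: lt_le_trans D1.
have eta0 : 0 < delta / D by rewrite divr_gt0.
have [rho rho0 rhoP] := relatively_dense delta cL dL eta0.
pose w : 'rV[R]_(d + m) := row_mx (const_mx (D * rho)) (const_mx delta).
have wl j : w 0 (lshift m j) = D * rho by rewrite row_mxEl mxE.
have wr j : w 0 (rshift d j) = delta by rewrite row_mxEr mxE.
pose P := diag_mx w.
have Pl k j : lsubmx (row k P) 0 j = P k (lshift m j) by rewrite mxE mxE.
have Pr k j : rsubmx (row k P) 0 j = P k (rshift d j) by rewrite mxE mxE.
have zP k : `|rsubmx (row k P)| <= delta.
  apply: normr_rV_le => [|j]; first exact: ltW.
  rewrite Pr [P _ _]mxE; case: (k =P _) => [->|_]; last by rewrite normr0 ltW.
  by rewrite wr gtr0_norm.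
have /choice[v vP] k : exists p, [/\ p \in L,
    `|p.1 - lsubmx (row k P)| <= rho & `|p.2 - rsubmx (row k P)| < delta / D].
  by have [p pL [p1 p2]] := rhoP (lsubmx (row k P)) _ (zP k); exists p.
exists v; split => [k||k]; first by have [] := vP k.
- apply/row_free_zfree/(@near_diag_row_free _ _ w) => [i|k i].
    by case: (split_ordP i) => j ->; rewrite ?wl ?wr // mulr_gt0.
  rewrite -/D -/P mxE; have [_ v1 v2] := vP k.
  case: (split_ordP i) => j ->.
    rewrite wl row_mxEl -Pl [leRHS]mulrAC divff ?gt_eqF // mul1r.
    exact: le_trans (normr_rV_coordB _ _ j) v1.
  rewrite wr row_mxEr -Pr.
  exact: le_trans (normr_rV_coordB _ _ j) (ltW v2).
- have [_ _ v2] := vP k; rewrite -(subrK (rsubmx (row k P)) (v k).2).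
  apply: le_trans (ler_normD _ _) _; rewrite [e]splitr; apply: lerD (zP k).
  by apply: le_trans (ltW v2) _; rewrite ler_pdivrMr // ler_peMr // ltW.
Qed.

(** * Arithmetic progressions in model sets *)

Unset Implicit Arguments.

Theorem theorem4p3 (R : realType) (d m : nat) (d_ge1 : (1 <= d)%N)
    (L : zmodClosed ('rV[R]_d * 'rV[R]_m)%type) (W : set 'rV[R]_m)
    (L_CPS : is_CPS L) (W_window : is_model_window W) :
  (forall (N n : nat) (s : 'rV[R]_d) (r : 'I_n -> 'rV[R]_d),
     (1 <= N)%N ->
     arith_prog N s r `<=` cut_project L W ->
     exists k : nat, has_zrank (zspan r) k /\ (k <= d + m)%N)
  /\
  (forall N : nat, exists2 rho : R, 0 < rho &
     forall y : 'rV[R]_d,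
       exists (n : nat) (s : 'rV[R]_d) (r : 'I_n -> 'rV[R]_d),
         [/\ zfree r,
             has_zrank (zspan r) (d + m)%N &
             arith_prog N s r `<=` cut_project L W `&` euclidean_ball y rho]).
Proof.
have [[discL cocL] injL denseL] := L_CPS; have [_ [w0]] := W_window.
rewrite /interior /= => /nbhs_normP[e /= e0 eW].
have rank_le n (r : 'I_n -> 'rV[R]_d) l (v : 'I_l -> 'rV[R]_d) :
    (forall i, (fst @` [set` L]) (r i)) ->
    (forall i, zspan r (v i)) -> zfree v -> (l <= d + m)%N.
  move=> rL vr; apply: (zfree_fst_le discL) => i.
  exact: (zspan_fst rL (vr i)).
split=> [N n s r N1 rW|N].
  apply: bounded_has_zrank => l v; apply: rank_le => i.
  have [y1 _ sL] := rW _ (arith_prog_start N s r).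
  have [y2 _ srL] := rW _ (arith_prog_ratio s r i N1).
  exists ((s + r i, y2) - (s, y1)); first exact: rpredB.
  by rewrite /= addrAC subrr add0r.
(* A combination of d + m short ratios with coefficients at most N must move
   by at most e / 2 in R^m; the other half of e is for the start. *)
pose D : R := (N * (d + m)).+1%:R.
have D0 : 0 < D by rewrite ltr0n.
have e2D0 : 0 < e / 2 / D by rewrite !divr_gt0.
have e20 : 0 < e / 2 by rewrite divr_gt0.
have [v [vL vfree v2]] := exists_short_zfree cocL denseL e2D0.
have [rho rho0 rhoP] := relatively_dense `|w0| cocL denseL e20.
pose b := rho + N%:R * \sum_j `|(v j).1|.
have b0 : 0 < b by rewrite ltr_pwDl // mulr_ge0 // sumr_ge0.
exists (d%:R * b + 1) => [|y]; first by rewrite ltr_wpDl // mulr_ge0 // ltW.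
have [p pL [p1 p2]] := rhoP y w0 (lexx _).
have rfree : zfree (fun j => (v j).1).
  move=> c c0; apply: vfree; apply: injL; rewrite ?inE ?rpred0 //.
    exact: zcomb_in.
  by rewrite raddf_sum -[RHS]c0; apply: eq_bigr => j _; rewrite raddfMz.
exists (d + m)%N, p.1, (fun j => (v j).1); split => //.
  split; first by exists (fun j => (v j).1); split => // i; exact: zspan_ratio.
  by move=> l u; apply: rank_le => i; exists (v i) => //; exact: vL.
move=> x [c c0N ->]; split; last first.
  apply: in_euclidean_ball; rewrite addrAC.
  by apply: le_trans (ler_normD _ _) _; apply: lerD p1 _; exact: normr_zcomb.
exists (p.2 + \sum_j (v j).2 *~ c j).
  apply: eW => /=; rewrite opprD addrA.
  apply: le_lt_trans (ler_normB _ _) _.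
  rewrite [e]splitr; apply: ltr_leD; first by rewrite distrC.
  apply: le_trans (normr_zcomb _ c0N) _.
  apply: (@le_trans _ _ (N%:R * \sum_(j < d + m) (e / 2 / D))).
    by apply: ler_wpM2l => //; apply: ler_sum => j _; exact: v2.
  rewrite sumr_const card_ord -[_ *+ (d + m)]mulr_natl mulrA -natrM.
  by rewrite mulrA ler_pdivrMr // mulrC ler_wpM2l ?(ltW e20) // ler_nat.
have -> : (p.1 + \sum_j (v j).1 *~ c j, p.2 + \sum_j (v j).2 *~ c j) =
    p + \sum_j v j *~ c j.
  rewrite [RHS]surjective_pairing /= !raddf_sum.
  by congr (_ + _, _ + _); apply: eq_bigr => j _; rewrite raddfMz.
by rewrite rpredD // zcomb_in.
Qed.
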